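(* Let $m\in\mathbb{Z}_+$ and let $B_0,\ldots,B_m$ be closed linear operators from $H$ to $H'$ with domains $\mathcal{D}(B_j)\subset H$ such that: $e_n\in\bigcap_{j=0}^m\mathcal{D}(B_j)$ for every $n\in M$; $(B_je_{n'},B_je_{n''})_{H'}=0$ for all $j\in\{0,\ldots,m\}$ and all $n',n''\in M$ with $n'\neq n''$; and there exist $j_0\in\{0,\ldots,m\}$ and $n_0\in M$ with $B_{j_0}e_{n_0}\neq0$. Let $A:H\to H'$ be a closable linear operator with domain $\mathcal{D}(A)\subset H$ such that $e_n\in\mathcal{D}(A)$ for every $n\in M$ and $Ae_{n_0}\neq0$ for some $n_0\in M$. Let $\lambda_0,\ldots,\lambda_m>0$ be such that $\lambda_0+\ldots+\lambda_m=1$ and $$\mathfrak{C}:=\sup_{\mathbf{h}\in\mathbb{R}_+^{m+1}}\ \prod_{j=0}^m h_j^{\lambda_j}\ \sup_{f\in H':\,\|f\|_{H'}\leqslant1}\ \widetilde{\sum_{n\in M}}\frac{|(f,Ae_n)_{H'}|^2}{b_{n,\mathbf{h}}}<\infty .$$ Then for every $x\in\mathcal{D}(A)\cap H_{\mathbf{B}}$, $$\|Ax\|_{H'}\leqslant\sqrt{\mathfrak{C}\cdot\prod_{j=0}^m\lambda_j^{-\lambda_j}}\cdot\prod_{j=0}^m\|B_jx\|_{H'}^{\lambda_j},$$ and this inequality is sharp (the constant cannot be replaced by a smaller one).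
   Context: $\mathbb{R}_+=(0,+\infty)$; $\mathbb{Z}_+$ is the set of non-negative integers. $H$ is a separable Hilbert space over $\mathbb{C}$ with orthonormal basis $\{e_n\}_{n\in M}$, $M$ finite or countable; $x_n:=(x,e_n)_H$. Sums over $M$ are limits of sums over a fixed sequence of nested finite sets $M_1\subset M_2\subset\ldots$ with union $M$. $H'$ is a Hilbert space over $\mathbb{C}$. For non-negative sequences $\{a_n\},\{b_n\}$, the sum $\widetilde{\sum}_{n\in M}\frac{a_n}{b_n}$ equals $+\infty$ if there is $n_0$ with $a_{n_0}\neq0$ and $b_{n_0}=0$, and otherwise equals $\sum_{n\in M:\,b_n\neq0}\frac{a_n}{b_n}$ (an empty sum is $0$). For $\mathbf{h}=(h_0,\ldots,h_m)\in\mathbb{R}_+^{m+1}$: $b_{n,\mathbf{h}}:=\sum_{j=0}^m h_j\|B_je_n\|_{H'}^2$. Further, $H_{\mathbf{B}}:=\{x\in H:\ \sum_{n\in M}|x_n|^2\|B_je_n\|_{H'}^2<\infty,\ j=0,\ldots,m\}$; under the stated hypotheses on the $B_j$ one has $H_{\mathbf{B}}\subset\bigcap_{j=0}^m\mathcal{D}(B_j)$. An operator is closable if the closure of its graph is the graph of an operator. *)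

(* Defs.v *)
From mathcomp Require Import all_boot all_order all_algebra.
From mathcomp Require Import finmap.
From mathcomp Require Import all_classical all_reals all_analysis.
From mathcomp Require Import sesquilinear.
From mathcomp Require Import complex.
Import Order.TTheory GRing.Theory Num.Theory.
Import numFieldNormedType.Exports.

Set Implicit Arguments.
Unset Strict Implicit.
Unset Printing Implicit Defensive.

Local Open Scope classical_set_scope.
Local Open Scope ring_scope.

(* The norm of a normed module over [R[i]] takes its values in [R[i]]; [rnorm]
   is the same (nonnegative real) number viewed in [R].  It is also used for the
   modulus of a complex number. *)
Definition rnorm (R : realType) (V : normedZmodType R[i]) (x : V) : R :=
  complex.Re `|x|.

(* A complex Hilbert space is a complete normed module over [R[i]] together with
   an inner product, linear in its first argument, inducing its norm. *)
Definition hilbert_ip (R : realType) (H : normedModType R[i])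
    (ip : {dot H for Num.conj}) : Prop :=
  forall x : H, ip x x = `|x| ^+ 2.

Section Operators.
Variables (K : numFieldType) (H H' : normedModType K).

(* A linear operator with domain: the values of [opfun] off [opdom] are
   irrelevant and are never constrained. *)
Record linop := LinOp {
  opdom : set H;
  opfun :> H -> H';
  opdom0 : opdom 0;
  opdomP : forall (a : K) (x y : H), opdom x -> opdom y -> opdom (a *: x + y);
  oplinear : forall (a : K) (x y : H), opdom x -> opdom y ->
    opfun (a *: x + y) = a *: opfun x + opfun y }.

Definition graph (T : linop) : set (H * H') :=
  [set p | opdom T p.1 /\ p.2 = T p.1].

Definition closed_op (T : linop) : Prop := closed (graph T).

Definition closable_op (T : linop) : Prop :=
  exists S : linop, closure (graph T) = graph S.

End Operators.

Section Sums.
Variables (R : realType) (M : countType) (Mk : nat -> {fset M}).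

(* [Mk] is the fixed sequence of nested finite sets defining sums over [M]. *)
Definition exhaustion : Prop :=
  (forall k, (Mk k `<=` Mk k.+1)%fset) /\ (forall n, exists k, n \in Mk k).

Definition sumM (a : M -> R) : \bar R :=
  limn (fun k => (\sum_(n <- Mk k) a n)%:E).

Definition tilde_sum (a b : M -> R) : \bar R :=
  if `[< exists n0, a n0 != 0 /\ b n0 = 0 >] then +oo%E
  else limn (fun k => (\sum_(n <- Mk k | b n != 0) a n / b n)%:E).

Definition orthonormal_basis (H : normedModType R[i])
    (ip : {dot H for Num.conj}) (e : M -> H) : Prop :=
  (forall n n', ip (e n) (e n') = (n == n')%:R) /\
  (forall x : H, (fun k => \sum_(n <- Mk k) ip x (e n) *: e n) @ \oo --> x).

End Sums.

Section Quantities.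
Variables (R : realType) (M : countType) (Mk : nat -> {fset M}).
Variables (H H' : normedModType R[i]).
Variables (ip : {dot H for Num.conj}) (ip' : {dot H' for Num.conj}).
Variables (e : M -> H) (m : nat).
Variables (B : 'I_m.+1 -> linop H H') (A : linop H H').

Definition bnh (h : 'I_m.+1 -> R) (n : M) : R :=
  \sum_(j < m.+1) h j * rnorm (B j (e n)) ^+ 2.

Definition HB_space : set H :=
  [set x | forall j : 'I_m.+1,
    (sumM Mk (fun n => (rnorm (ip x (e n)) ^+ 2 * rnorm (B j (e n)) ^+ 2)%R)
       < +oo)%E].

Definition frakC (lam : 'I_m.+1 -> R) : \bar R :=
  ereal_sup [set ((\prod_(j < m.+1) h j `^ lam j)%:E *
      ereal_sup [set tilde_sum Mk (fun n => (rnorm (ip' f (A (e n))) ^+ 2)%R)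
                                  (bnh h)
                | f in [set f : H' | (rnorm f <= 1)%R]])%E
    | h in [set h : 'I_m.+1 -> R | forall j, (0 < h j)%R]].

End Quantities.

Lemma rnormE (R : realType) (V : normedZmodType R[i]) (x : V) :
  (rnorm x)%:C%C = `|x|.
Proof. by rewrite /rnorm RRe_real// normr_real. Qed.

Lemma opdom_sum (K : numFieldType) (H H' : normedModType K) (T : linop H H')
    (I : Type) (s : seq I) (c : I -> K) (v : I -> H) :
  (forall i, opdom T (v i)) ->
  opdom T (\sum_(i <- s) c i *: v i) /\
  T (\sum_(i <- s) c i *: v i) = \sum_(i <- s) c i *: T (v i).
Proof.
move=> dv; elim: s => [|i s [ds Ts]].
  rewrite !big_nil; split; first exact: opdom0.
  have := oplinear (-1) (opdom0 T) (opdom0 T).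
  by rewrite scaler0 add0r => {1}->; rewrite scaleN1r addNr.
by rewrite !big_cons; split; [exact: opdomP|rewrite oplinear// Ts].
Qed.

Lemma dot_sum_orthogonal (C : numClosedFieldType) (U : lmodType C)
    (ip : {dot U for Num.conj}) (M : eqType) (s : seq M) (P : pred M)
    (c : M -> C) (v : M -> U) : uniq s ->
  (forall n n', n != n' -> ip (v n) (v n') = 0) ->
  ip (\sum_(n <- s | P n) c n *: v n) (\sum_(n <- s | P n) c n *: v n) =
  \sum_(n <- s | P n) `|c n| ^+ 2 * ip (v n) (v n).
Proof.
move=> + o; elim: s => [_|a s IH /= /andP[nas us]].
  by rewrite !big_nil linear0l.
rewrite !big_cons; case: ifP => Pa; last exact: IH.
have z1 : ip (c a *: v a) (\sum_(n <- s | P n) c n *: v n) = 0.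
  rewrite linear_sumr/= big_seq_cond big1// => n /andP[ns _].
  rewrite linearZl_LR linearZr_LR/= o ?mulr0//.
  by apply: contraNneq nas => ->.
set w := \sum_(n <- s | P n) _ in z1 IH *.
have z2 : ip w (c a *: v a) = 0.
  apply: etrans (hermC _ _ _) _.
  apply: etrans (congr1 (fun z => (-1) ^+ false * Num.conj z) z1) _.
  by rewrite rmorph0 mulr0.
have -> : ip (c a *: v a + w) (c a *: v a + w) =
    ip (c a *: v a) (c a *: v a) + ip (c a *: v a) w +
    (ip w (c a *: v a) + ip w w) by rewrite linearDl !linearDr.
by rewrite z1 z2 addr0 add0r IH// dnormZ.
Qed.

(* By this inclusion [B j x] is a genuine value of [B j] for every [x] in
   [HB_space], never one taken off its domain. *)
Lemma HB_space_sub_opdom (R : realType) (H H' : completeNormedModType R[i])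
    (ip : {dot H for Num.conj}) (ip' : {dot H' for Num.conj})
    (M : countType) (Mk : nat -> {fset M}) (e : M -> H) (m : nat)
    (B : 'I_m.+1 -> linop H H') :
  hilbert_ip ip' -> exhaustion Mk -> orthonormal_basis Mk ip e ->
  (forall j, closed_op (B j)) -> (forall j n, opdom (B j) (e n)) ->
  (forall j n' n'', n' != n'' -> ip' (B j (e n')) (B j (e n'')) = 0) ->
  HB_space Mk ip e B `<=` \bigcap_j opdom (B j).
Proof.
move=> hip' [Mmono Mcov] [_ xE] Bcl Bdom Borth x xHB j _.
have {xHB} := xHB j; set sx := sumM _ _ => xHB.
pose S k := \sum_(n <- Mk k) rnorm (ip x (e n)) ^+ 2 * rnorm (B j (e n)) ^+ 2.
pose y k : H' := \sum_(n <- Mk k) ip x (e n) *: B j (e n).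
have Msub k l : (k <= l)%N -> (Mk k `<=` Mk l)%fset.
  elim: l => [|l IH]; first by rewrite leqn0 => /eqP->.
  rewrite leq_eqVlt => /predU1P[->//|]; rewrite ltnS => /IH h.
  exact: fsubset_trans h (Mmono l).
have split_sum (V : nmodType) (F : M -> V) k l : (k <= l)%N ->
    \sum_(n <- Mk l) F n =
    \sum_(n <- Mk k) F n + \sum_(n <- Mk l | n \notin Mk k) F n.
  move=> /Msub kl; rewrite (bigID (fun n => n \in Mk k))/=; congr (_ + _).
  rewrite -big_filter; apply: perm_big; apply: uniq_perm => //.
    by apply: filter_uniq; exact: fset_uniq.
    exact: fset_uniq.
  move=> n; rewrite mem_filter; case: (boolP (n \in Mk k)) => //= nk.
  exact: (fsubsetP kl).
have pyth (s : seq M) (P : pred M) (c : M -> R[i]) : uniq s ->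
    ip' (\sum_(n <- s | P n) c n *: B j (e n))
        (\sum_(n <- s | P n) c n *: B j (e n)) =
    (\sum_(n <- s | P n) rnorm (c n) ^+ 2 * rnorm (B j (e n)) ^+ 2)%:C%C.
  move=> us; rewrite (dot_sum_orthogonal _ _ us (Borth j)) rmorph_sum/=.
  by apply: eq_bigr => n _; rewrite rmorphM/= !rmorphXn/= !rnormE hip'.
have Sdiff k l : (k <= l)%N -> `|y l - y k| ^+ 2 = (S l - S k)%:C%C.
  move=> kl; rewrite /y /S (split_sum _ _ _ _ kl) (split_sum _ _ _ _ kl).
  rewrite [_ + _ - _]addrAC subrr add0r [_ + _ - _]addrAC subrr add0r.
  by rewrite -hip' pyth; last exact: fset_uniq.
have Smono : nondecreasing_seq S.
  move=> k l kl; rewrite /S (split_sum _ _ _ _ kl) lerDl.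
  by apply: sumr_ge0 => n _; rewrite mulr_ge0// sqr_ge0.
have cS : cvgn S.
  apply: nondecreasing_is_cvgn => //.
  have bnd k : ((S k)%:E <= sx)%E.
    have nd : nondecreasing_seq (EFin \o S).
      by move=> a b ab; rewrite lee_fin Smono.
    have -> : sx = ereal_sup (range (EFin \o S)).
      exact/cvg_lim/ereal_nondecreasing_cvgn.
    by apply: ereal_sup_ubound; exists k.
  have s0 : (0 <= sx)%E.
    apply: le_trans (bnd 0%N); rewrite lee_fin /S.
    by apply: sumr_ge0 => n _; rewrite mulr_ge0// sqr_ge0.
  have sfin := ge0_fin_numE s0; rewrite xHB in sfin.
  exists (fine (sx)).
  by move=> _ [k _ <-]; rewrite -lee_fin fineK.
have cy : cvgn y.
  apply/cauchy_cvgP; apply: cauchy_exP => eps eps0.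
  have epsE : eps = (complex.Re eps)%:C%C by rewrite RRe_real// ger0_real// ltW.
  have r0 : 0 < complex.Re eps by rewrite -ltcR -epsE.
  have : \forall k \near \oo, limn S - complex.Re eps ^+ 2 < S k.
    by apply: (cvgr_gt _ cS); rewrite gtrBl exprn_gt0.
  move=> [N _ NS]; exists (y N); exists N => // k /= Nk.
  rewrite -ball_normE /= distrC -(@ltr_pXn2r _ 2) ?nnegrE// ?(ltW eps0)//.
  rewrite Sdiff// epsE -rmorphXn/= ltcR ltrBlDr -ltrBlDl.
  apply: le_lt_trans (NS N (leqnn N)).
  by rewrite lerD2r; exact: nondecreasing_cvgn_le.
have := @closed_cvg nat _ \oo _
  (fun k => (\sum_(n <- Mk k) ip x (e n) *: e n, y k))
  _ (Bcl j) _ (x, limn y).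
case=> //; last by apply: cvg_pair => //; exact: xE.
near=> k; split=> /=;
  by have [] := opdom_sum (Mk k) (fun n => ip x (e n)) (Bdom j).
Unshelve. all: end_near.
Qed.

(* Main.v *)
(** Fix [h] and let [S] be the supremum over the unit ball of the tilde sum. For
    finite sums, Cauchy-Schwarz gives
    [|sum c_n A e_n|^2 <= S * sum |c_n|^2 b_(n,h)], and orthogonality of the
    [B_j e_n] turns the right-hand sum into [sum_j h_j |B_j x|^2].  As the bound
    also makes the partial sums of [sum x_n A e_n] Cauchy, closability of [A]
    carries it to every [x] in [D(A)] and [H_B].  Choosing
    [h_j = lam_j / (|B_j x|^2 + t)] and letting [t -> 0+] yields the inequality;
    the shift by [t] covers the case where some [B_j x] vanish.
    For sharpness, the test vectors [x = sum (f, A e_n) / b_(n,h) e_n] over finite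
    sets make [(A x, f)] and [sum_j h_j |B_j x|^2] both equal to the partial tilde
    sum, and the weighted AM-GM inequality bounds [prod_j |B_j x|^lam_j] by the
    latter. *)
Require Import Defs.
From mathcomp Require Import all_boot all_order all_algebra.
From mathcomp Require Import finmap.
From mathcomp Require Import all_classical all_reals all_analysis.
From mathcomp Require Import sesquilinear complex.
From mathcomp Require Import ring lra.
Import Order.TTheory GRing.Theory Num.Theory.
Import numFieldNormedType.Exports.

Set Implicit Arguments.
Unset Strict Implicit.
Unset Printing Implicit Defensive.

Local Open Scope classical_set_scope.
Local Open Scope ring_scope.

Lemma realC_inj (R : realType) : injective (fun r : R => r%:C%C).
Proof. by move=> x y []. Qed.

(** * Real-valued norms and moduli *)

Section Norm.
Variables (R : realType) (V : normedZmodType R[i]).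
Implicit Types x : V.

Lemma rnorm_ge0 x : 0 <= rnorm x.
Proof. by rewrite -lecR rnormE rmorph0. Qed.

Lemma rnorm0 : rnorm (0 : V) = 0.
Proof. by rewrite /rnorm normr0. Qed.

Lemma rnorm_eq0 x : (rnorm x == 0) = (x == 0).
Proof. by rewrite -(normr_eq0 x) -rnormE (inj_eq (@realC_inj R)). Qed.

End Norm.

Section NormedModule.
Variables (R : realType) (V : normedModType R[i]).
Implicit Types (x y : V) (r : R).

Lemma rnormZ (a : R[i]) x : rnorm (a *: x) = rnorm a * rnorm x.
Proof. by apply: realC_inj; rewrite rmorphM/= !rnormE normrZ. Qed.

Lemma rnorm_real r : 0 <= r -> rnorm (r%:C%C : R[i]) = r.
Proof.
by move=> r0; apply: realC_inj; rewrite rnormE ger0_norm// lecR.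
Qed.

Lemma ler_rnorm_dist x y : `|rnorm x - rnorm y| <= rnorm (x - y).
Proof.
have D (u v : V) : rnorm u <= rnorm (u - v) + rnorm v.
  by rewrite -lecR rmorphD/= !rnormE -{1}[u](subrK v) ler_normD.
have N (u : V) : rnorm (- u) = rnorm u by rewrite /rnorm normrN.
rewrite ler_norml lerBlDr D andbT lerNl opprB lerBlDr.
by rewrite -(N (x - y)) opprB D.
Qed.

Lemma cvg_rnorm (T : Type) (F : set_system T) {FF : Filter F} (f : T -> V) l :
  f @ F --> l -> rnorm (f t) @[t --> F] --> rnorm l.
Proof.
move=> fl; apply/cvgrPdist_lt => eps eps0.
have := (cvgrPdist_lt f l).1 fl eps%:C%C; rewrite ltcR => /(_ FF eps0).
apply: filterS => t lt_eps; apply: le_lt_trans (ler_rnorm_dist _ _) _.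
by rewrite -ltcR rnormE.
Qed.

End NormedModule.

Lemma rnorm_sum_le (R : realType) (I : Type) (s : seq I) (z : I -> R[i]) :
  rnorm (\sum_(i <- s) z i) <= \sum_(i <- s) rnorm (z i).
Proof.
rewrite -lecR rnormE rmorph_sum/=; apply: le_trans (ler_norm_sum _ _ _) _.
by apply: ler_sum => i _; rewrite rnormE.
Qed.

Lemma rnormM (R : realType) (a b : R[i]) : rnorm (a * b) = rnorm a * rnorm b.
Proof. by apply: realC_inj; rewrite rmorphM/= !rnormE normrM. Qed.

Lemma rnorm_conj (R : realType) (a : R[i]) : rnorm (Num.conj a) = rnorm a.
Proof. by rewrite /rnorm norm_conjC. Qed.

(** Weighted AM-GM, from the tangent-line bound [ln u <= u - 1] at [u = a i / S], with [S] the
    weighted mean. *)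
Lemma prod_powR_le_sum (R : realType) (I : finType) (lam a : I -> R) :
  (forall i, 0 < lam i) -> \sum_i lam i = 1 -> (forall i, 0 <= a i) ->
  \prod_i a i `^ lam i <= \sum_i lam i * a i.
Proof.
move=> lam0 lam1 a0.
(* A vanishing [a i] makes the product zero because [lam i > 0]; otherwise logarithms are
   available. *)
have [[i ai0]|ane0] := pselect (exists i, a i = 0).
  rewrite (bigD1 i)//= ai0 powR0 ?gt_eqF// mul0r.
  by apply: sumr_ge0 => j _; rewrite mulr_ge0// ltW.
have agt0 i : 0 < a i.
  by rewrite lt_neqAle a0 eq_sym andbT; apply/eqP => ai0; apply: ane0; exists i.
set S := \sum_i _.
have S0 : 0 < S.
  have [i _|I0] := pickP (@predT I); last first.
    by move: lam1; rewrite big_pred0// => /esym/eqP; rewrite oner_eq0.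
  rewrite /S (bigD1 i)//= ltr_wpDr ?mulr_gt0//.
  by apply: sumr_ge0 => j _; rewrite mulr_ge0// ltW.
have -> : \prod_i a i `^ lam i = expR (\sum_i lam i * ln (a i)).
  by rewrite expR_sum; apply: eq_bigr => i _; rewrite /powR gt_eqF.
rewrite -[leRHS]lnK// ler_expR -subr_le0.
rewrite -[ln S]mul1r -lam1 mulr_suml -sumrB.
(* Writing [0] as this sum reduces the claim to a termwise comparison. *)
have {2}<- : \sum_i lam i * (a i / S - 1) = 0.
  under eq_bigr do rewrite mulrBr mulr1 mulrA.
  by rewrite sumrB lam1 -mulr_suml divff ?gt_eqF// subrr.
apply: ler_sum => i _; rewrite -mulrBr ler_pM2l// -ln_div ?posrE//.
have := expR_ge1Dx (ln (a i / S)); rewrite lnK ?posrE ?divr_gt0//.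
by rewrite addrC -lerBrDr.
Qed.

(** For [y > 0] this is continuity of [expR (p * ln _)]. The case [y = 0], where [0 < p] matters,
    serves the indices [j] with [B_j x = 0]. *)
Lemma cvg_powRD_right (R : realType) (y p : R) : 0 <= y -> 0 < p ->
  (y + t) `^ p @[t --> 0^'+] --> y `^ p.
Proof.
rewrite le_eqVlt => /predU1P[<-|y0] p0.
  by rewrite powR0 ?gt_eqF//; under eq_fun do rewrite add0r; exact: powR_cvg0.
apply: cvg_at_right_filter.
have yt : y + t @[t --> (0 : R)] --> y + 0 by apply: cvgD; [exact: cvg_cst|exact: cvg_id].
rewrite addr0 in yt.
rewrite {2}/powR gt_eqF//.
have : expR (p * ln (y + t)) @[t --> (0 : R)] --> expR (p * ln y).
  apply: continuous_cvg; first exact: continuous_expR.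
  apply: cvgM; first exact: cvg_cst.
  exact: (cvg_comp _ _ yt (continuous_ln y0)).
apply: cvg_trans; apply: near_eq_cvg.
near=> t; rewrite /powR gt_eqF//.
near: t; exact: (cvgr_gt _ yt).
Unshelve. all: end_near. Qed.

(** * Cauchy-Schwarz type estimates and Pythagoras *)

Section InnerProduct.
Variables (R : realType) (V : normedModType R[i]) (ip : {dot V for Num.conj}).
Hypothesis hip : hilbert_ip ip.
Implicit Types u v f : V.

Lemma ip_rnorm v : ip v v = (rnorm v ^+ 2)%:C%C.
Proof. by rewrite rmorphXn/= rnormE hip. Qed.

Lemma rnorm_ipC u v : rnorm (ip u v) = rnorm (ip v u).
Proof.
have -> : ip u v = Num.conj (ip v u).
  by apply: etrans (hermC _ _ _) _; rewrite mul1r.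
exact: rnorm_conj.
Qed.

Lemma conjc_realC (r : R) : Num.conj (r%:C%C : R[i]) = r%:C%C.
Proof. by apply/CrealP; rewrite complex_real. Qed.

(** Expand [0 <= |v - T f|^2 = |v|^2 - 2 T^2 + T^2 |f|^2] and use [|f| <= 1]. *)
Lemma ip_le_rnorm (T : R) v f :
  ip v f = T%:C%C -> rnorm f <= 1 -> 0 <= T -> T <= rnorm v.
Proof.
move=> vf f1 T0.
have d : ip v (T%:C%C *: f) = (T ^+ 2)%:C%C.
  by rewrite linearZr_LR/= vf conjc_realC -rmorphM.
have := dnorm_ge0 ip (v - T%:C%C *: f).
rewrite dnormB d dnormZ !ip_rnorm conjc_realC -rnormE rnorm_real//.
rewrite -rmorphXn -rmorphM -!rmorphD -rmorphB/= -[0]/(0%:C%C) lecR => h.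
have Tf : T ^+ 2 * rnorm f ^+ 2 <= T ^+ 2.
  by rewrite ler_piMr ?sqr_ge0// expr_le1// rnorm_ge0.
rewrite -(@ler_pXn2r _ 2) ?nnegrE ?rnorm_ge0//.
lra.
Qed.

(** Duality: the norm of the sum [w] is its pairing with the unit vector [w / |w|], and the
    hypothesis on tested sums is applied to that vector. Terms with [b n = 0] drop out since
    [v n = 0] there. *)
Lemma rnorm_sqr_sum_le (I : Type) (s : seq I) (v : I -> V) (c : I -> R[i])
    (b : I -> R) (S : R) : 0 < S -> (forall n, 0 <= b n) ->
  (forall n, b n = 0 -> v n = 0) ->
  (forall f, rnorm f <= 1 ->
     \sum_(n <- s) rnorm (ip f (v n)) ^+ 2 / b n <= S) ->
  rnorm (\sum_(n <- s) c n *: v n) ^+ 2 <=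
  S * \sum_(n <- s) rnorm (c n) ^+ 2 * b n.
Proof.
move=> S0 b0 bv0 hS; set w := \sum_(n <- s) _; set X := \sum_(n <- s) _.
have X0 : 0 <= X by apply: sumr_ge0 => n _; rewrite mulr_ge0// sqr_ge0.
have [->|w0] := eqVneq w 0.
  by rewrite rnorm0 expr0n mulr_ge0// ltW.
set N := rnorm w.
have N0 : 0 < N by rewrite lt_neqAle eq_sym rnorm_eq0 w0 rnorm_ge0.
pose f := (N^-1)%:C%C *: w.
have f1 : rnorm f = 1.
  by rewrite rnormZ rnorm_real ?invr_ge0 ?ltW// mulVf// gt_eqF.
have NE : N = rnorm (ip w f).
  rewrite /f linearZr_LR/= conjc_realC ip_rnorm -rmorphM/= rnorm_real.
    by rewrite expr2 mulKf// gt_eqF.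
  by rewrite mulr_ge0 ?sqr_ge0// invr_ge0 ltW.
have N1 : N <= \sum_(n <- s) rnorm (c n) * rnorm (ip f (v n)).
  rewrite {1}NE /w linear_sumlz/=; apply: le_trans (rnorm_sum_le _ _) _.
  by apply: ler_sum => n _; rewrite linearZl_LR/= rnormM rnorm_ipC.
(* AM-GM: [2 p q <= (S / N) b p^2 + (N / S) q^2 / b] *)
have N2 : 2 * N <= S / N * X +
    N / S * \sum_(n <- s) rnorm (ip f (v n)) ^+ 2 / b n.
  have := ler_wpM2l (ler0n R 2) N1; move/le_trans; apply.
  rewrite !mulr_sumr -big_split/=; apply: ler_sum => n _.
  have [bn0|bn0] := eqVneq (b n) 0.
    by rewrite bv0// linear0r rnorm0 bn0 invr0 !mulr0 addr0.
  have bn : 0 < b n by rewrite lt_neqAle eq_sym bn0 b0.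
  set p := rnorm _; set q := rnorm _.
  rewrite -subr_ge0.
  have -> : S / N * (p ^+ 2 * b n) + N / S * (q ^+ 2 / b n) - 2 * (p * q) =
      (S * b n * p - N * q) ^+ 2 / (S * N * b n).
    by field; rewrite !gt_eqF.
  by rewrite mulr_ge0 ?sqr_ge0// invr_ge0 !mulr_ge0// ltW.
(* The AM-GM weights are chosen so that the tested sum, at most [S], contributes at most [N], which
   half of the left side absorbs. *)
have N3 : 2 * N <= S / N * X + N.
  apply: (le_trans N2); rewrite lerD2l.
  apply: (@le_trans _ _ (N / S * S)); last by rewrite mulfVK// gt_eqF.
  by apply: ler_wpM2l; [rewrite divr_ge0// ltW|apply: hS; rewrite f1].
have : N <= S * X / N by rewrite mulrAC; lra.
by rewrite ler_pdivlMr.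
Qed.

Lemma rnorm_sqr_sum_orthogonal (M : choiceType) (s : {fset M}) (v : M -> V)
    (c : M -> R[i]) : (forall n n', n != n' -> ip (v n) (v n') = 0) ->
  rnorm (\sum_(n <- s) c n *: v n) ^+ 2 =
  \sum_(n <- s) rnorm (c n) ^+ 2 * rnorm (v n) ^+ 2.
Proof.
move=> o; apply: realC_inj; rewrite -ip_rnorm (dot_sum_orthogonal _ _ (fset_uniq s) o).
by rewrite rmorph_sum; apply: eq_bigr => n _; rewrite rmorphM/= -rnormE -ip_rnorm rmorphXn.
Qed.

End InnerProduct.

(** * Sums along the exhaustion *)

Section Sums.
Variables (R : realType) (M : countType) (Mk : nat -> {fset M}).
Hypothesis hMk : exhaustion Mk.

Lemma exhaustion_sub k l : (k <= l)%N -> (Mk k `<=` Mk l)%fset.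
Proof.
have [Mmono _] := hMk.
elim: l => [|l IH]; first by rewrite leqn0 => /eqP->.
rewrite leq_eqVlt => /predU1P[->//|]; rewrite ltnS => /IH h.
exact: fsubset_trans h (Mmono l).
Qed.

Lemma exhaustion_sum_split (V : nmodType) (F : M -> V) k l : (k <= l)%N ->
  \sum_(n <- Mk l) F n =
  \sum_(n <- Mk k) F n + \sum_(n <- Mk l | n \notin Mk k) F n.
Proof.
move=> /exhaustion_sub kl; rewrite (bigID (fun n => n \in Mk k))/=.
congr (_ + _); rewrite -big_filter; apply: perm_big; apply: uniq_perm => //.
- by apply: filter_uniq; exact: fset_uniq.
- exact: fset_uniq.
move=> n; rewrite mem_filter; case: (boolP (n \in Mk k)) => //= nk.
exact: (fsubsetP kl).
Qed.

Lemma exhaustion_sum_le (a : M -> R) : (forall n, 0 <= a n) ->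
  nondecreasing_seq (fun k => \sum_(n <- Mk k) a n).
Proof.
by move=> a0 k l kl; rewrite (exhaustion_sum_split _ kl) lerDl sumr_ge0.
Qed.

(** Nonnegative terms make the partial sums monotone, so the limit exists in the extended reals and
    is their supremum. *)
Lemma exhaustion_limn (a : M -> R) : (forall n, 0 <= a n) ->
  limn (fun k => (\sum_(n <- Mk k) a n)%:E) =
  ereal_sup (range (fun k => (\sum_(n <- Mk k) a n)%:E)).
Proof.
move=> a0; apply/cvg_lim => //; apply: ereal_nondecreasing_cvgn => k l kl.
by rewrite lee_fin exhaustion_sum_le.
Qed.

Lemma limn_exhaustion_le (a : M -> R) (S : \bar R) : (forall n, 0 <= a n) ->
  (limn (fun k => (\sum_(n <- Mk k) a n)%:E) <= S)%E <->
  forall k, ((\sum_(n <- Mk k) a n)%:E <= S)%E.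
Proof.
move=> a0; rewrite exhaustion_limn//; split => [h k|h].
  by apply: le_trans h; apply: ereal_sup_ubound; exists k.
by apply: ge_ereal_sup => _ [k _ <-].
Qed.

Lemma sumM_lty (a : M -> R) : (forall n, 0 <= a n) -> (sumM Mk a < +oo)%E ->
  exists S : R, forall k, \sum_(n <- Mk k) a n <= S.
Proof.
move=> a0 fin; exists (fine (sumM Mk a)) => k.
have := (limn_exhaustion_le (sumM Mk a) a0).1 (lexx _).
have s0 : (0 <= sumM Mk a)%E.
  rewrite /sumM exhaustion_limn//.
  apply: (@le_trans _ _ (\sum_(n <- Mk 0%N) a n)%:E).
    by rewrite lee_fin sumr_ge0.
  by apply: ereal_sup_ubound; exists 0%N.
by move=> /(_ k); rewrite -lee_fin fineK// ge0_fin_numE.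
Qed.

Lemma sumM_finite_support_lty (a : M -> R) k : (forall n, 0 <= a n) ->
  (forall n, n \notin Mk k -> a n = 0) -> (sumM Mk a < +oo)%E.
Proof.
move=> a0 ak; apply: (@le_lt_trans _ _ (\sum_(n <- Mk k) a n)%:E).
  apply/limn_exhaustion_le => // l; rewrite lee_fin.
  apply: le_trans (exhaustion_sum_le a0 (leq_maxl l k)) _.
  rewrite (exhaustion_sum_split _ (leq_maxr l k)).
  by rewrite [X in _ + X]big1 ?addr0.
exact: ltry.
Qed.

Lemma tilde_sum_le (a b : M -> R) (S : R) :
  (forall n, 0 <= a n) -> (forall n, 0 <= b n) ->
  (tilde_sum Mk a b <= S%:E)%E <->
  (forall n, b n = 0 -> a n = 0) /\ (forall k, \sum_(n <- Mk k) a n / b n <= S).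
Proof.
move=> a0 b0; rewrite /tilde_sum.
have ab0 n : 0 <= a n / b n by rewrite divr_ge0.
(* Division by zero gives [0], so terms with [b n = 0] may be kept in the sum. *)
have -> : (fun k => (\sum_(n <- Mk k | b n != 0) a n / b n)%:E) =
    (fun k => (\sum_(n <- Mk k) a n / b n)%:E).
  apply/funext => k; congr EFin; rewrite big_mkcond/=; apply: eq_bigr => n _.
  by have [->|//] := eqVneq; rewrite invr0 mulr0.
case: asboolP => [[n [an bn]]|H].
  by rewrite leye_eq; split => // -[/(_ n bn)/eqP]; rewrite (negPf an).
rewrite limn_exhaustion_le//; split => [h|[_ h]]; last first.
  by move=> k; rewrite lee_fin.
split => [n bn|k]; last by rewrite -lee_fin.
by apply/eqP/negPn/negP => an; apply: H; exists n.
Qed.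

(** The squared increments are dominated by those of a bounded nondecreasing real sequence, so the
    sums are Cauchy. This serves both the [B j] and [A]. *)
Lemma dominated_sum_cvg (V : completeNormedModType R[i]) (v : M -> V)
    (x : M -> R[i]) (w : M -> R) (S : R) : (forall n, 0 <= w n) ->
  (forall k (c : M -> R[i]),
     rnorm (\sum_(n <- Mk k) c n *: v n) ^+ 2 <=
     \sum_(n <- Mk k) rnorm (c n) ^+ 2 * w n) ->
  (forall k, \sum_(n <- Mk k) rnorm (x n) ^+ 2 * w n <= S) ->
  cvgn (fun k => \sum_(n <- Mk k) x n *: v n).
Proof.
move=> w0 dom bnd.
pose T k := \sum_(n <- Mk k) rnorm (x n) ^+ 2 * w n.
pose y k := \sum_(n <- Mk k) x n *: v n.
have t0 n : 0 <= rnorm (x n) ^+ 2 * w n by rewrite mulr_ge0 ?sqr_ge0.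
have Tmono : nondecreasing_seq T by exact: exhaustion_sum_le.
have cT : cvgn T by apply: nondecreasing_is_cvgn => //; exists S => _ [k _ <-]; exact: bnd.
have ydiff k l : (k <= l)%N -> rnorm (y l - y k) ^+ 2 <= T l - T k.
  move=> kl; rewrite /y /T !(exhaustion_sum_split _ kl).
  rewrite ![_ + _ - _]addrAC !subrr !add0r !(big_mkcond (fun n => n \notin _)).
  (* Since [dom] holds for all coefficients, zeroing those on [Mk k] turns the sum over [Mk l] into
     the increment [y l - y k]. *)
  pose c n := if n \notin Mk k then x n else 0.
  have := dom l c; congr (rnorm _ ^+ 2 <= _); apply: eq_bigr => n _.
    by rewrite /c; case: ifP => //; rewrite scale0r.
  by rewrite /c; case: ifP => //; rewrite rnorm0 expr0n mul0r.
apply/cauchy_cvgP; apply: cauchy_exP => eps eps0.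
have epsE : eps = (complex.Re eps)%:C%C by rewrite RRe_real// ger0_real// ltW.
have r0 : 0 < complex.Re eps by rewrite -ltcR -epsE.
have : \forall k \near \oo, limn T - complex.Re eps ^+ 2 < T k.
  by apply: (cvgr_gt _ cT); rewrite gtrBl exprn_gt0.
move=> [N _ NT]; exists (y N); exists N => // k /= Nk.
rewrite -ball_normE /= distrC epsE -rnormE ltcR.
rewrite -(@ltr_pXn2r _ 2) ?nnegrE ?rnorm_ge0// ?(ltW r0)//.
apply: le_lt_trans (ydiff _ _ Nk) _; rewrite ltrBlDr -ltrBlDl.
apply: le_lt_trans (NT N (leqnn N)).
by rewrite lerD2r; exact: nondecreasing_cvgn_le.
Qed.

End Sums.

(** * Limits through closed and closable operators *)

Lemma closed_closable (K : numFieldType) (H H' : normedModType K)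
  (T : linop H H') : closed_op T -> closable_op T.
Proof. by move=> Tcl; exists T; apply/esym/closure_id. Qed.

(** Both [(x, y)] and [(x, T x)] lie in the closure of the graph, which is single-valued, being the
    graph of some [S]. *)
Lemma closable_limE (K : numFieldType) (H H' : normedModType K)
    (T : linop H H') (u : nat -> H) (x : H) (y : H') : closable_op T ->
  (forall k, opdom T (u k)) -> opdom T x ->
  u @ \oo --> x -> (T \o u) @ \oo --> y -> T x = y.
Proof.
move=> [S TS] du dx ux uy.
have [_ /= ->] : graph S (x, y).
  rewrite -TS.
  apply: (@closed_cvg nat _ \oo _ (fun k => (u k, T (u k))) _
    (@closed_closure _ (graph T)) _ (x, y)).
    by near=> k; apply: subset_closure; exact: (conj (du _) erefl).
  exact: cvg_pair.
suff [_ /= ->] : graph S (x, T x) by [].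
by rewrite -TS; apply: subset_closure.
Unshelve. all: end_near.
Qed.

Lemma closable_sumE (R : realType) (H H' : normedModType R[i])
    (ip : {dot H for Num.conj}) (M : countType) (Mk : nat -> {fset M})
    (e : M -> H) (T : linop H H') (x : H) :
  orthonormal_basis Mk ip e -> closable_op T ->
  (forall n, opdom T (e n)) -> opdom T x ->
  cvgn (fun k => \sum_(n <- Mk k) ip x (e n) *: T (e n)) ->
  (fun k => \sum_(n <- Mk k) ip x (e n) *: T (e n)) @ \oo --> T x.
Proof.
move=> [_ /(_ x) xE] Tcl Te dx cv.
have TE k := opdom_sum (Mk k) (fun n => ip x (e n)) Te.
suff -> : T x = limn (fun k => \sum_(n <- Mk k) ip x (e n) *: T (e n)) by [].
apply: (closable_limE Tcl _ dx xE) => [k|]; first by have [] := TE k.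
have -> // : T \o (fun k => \sum_(n <- Mk k) ip x (e n) *: e n) =
  (fun k => \sum_(n <- Mk k) ip x (e n) *: T (e n)).
by apply/funext => k /=; have [] := TE k.
Qed.

(** Splits the nested suprema into one bound per [h] and [f]; the product of powers is positive, so
    it can be divided out. One direction serves the inequality, the other sharpness. *)
Lemma frakC_le (R : realType) (M : countType) (Mk : nat -> {fset M})
    (H H' : normedModType R[i]) (ip' : {dot H' for Num.conj}) (e : M -> H)
    (m : nat) (B : 'I_m.+1 -> linop H H') (A : linop H H')
    (lam : 'I_m.+1 -> R) (C : R) :
  (frakC Mk ip' e B A lam <= C%:E)%E <->
  forall h, (forall j, 0 < h j) -> forall f, rnorm f <= 1 ->
    (tilde_sum Mk (fun n => (rnorm (ip' f (A (e n))) ^+ 2)%R) (bnh e B h) <=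
     (C / \prod_(j < m.+1) h j `^ lam j)%:E)%E.
Proof.
have p0 (h : 'I_m.+1 -> R) : (forall j, 0 < h j) ->
    0 < \prod_(j < m.+1) h j `^ lam j.
  by move=> h0; apply: prodr_gt0 => j _; rewrite powR_gt0.
split => [hC h h0 f f1|hC].
  rewrite mulrC EFinM lee_pdivlMl ?p0//; apply: le_trans hC.
  apply: le_trans (ereal_sup_ubound _); last by exists h.
  by apply: lee_wpmul2l; [rewrite lee_fin ltW// p0|apply: ereal_sup_ubound; exists f].
apply: ge_ereal_sup => _ [h h0 <-].
rewrite -lee_pdivlMl ?p0//; apply: ge_ereal_sup => _ [f f1 <-].
by rewrite -EFinM mulrC; exact: hC.
Qed.

Lemma bnh_ge0 (R : realType) (M : countType) (H H' : normedModType R[i])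
    (e : M -> H) (m : nat) (B : 'I_m.+1 -> linop H H') (h : 'I_m.+1 -> R) n :
  (forall j, 0 < h j) -> 0 <= bnh e B h n.
Proof.
by move=> h0; apply: sumr_ge0 => j _; rewrite mulr_ge0 ?sqr_ge0// ltW.
Qed.

(** * Additive inequality at fixed [h], sharpness, multiplicative inequality *)

Section Kolmogorov.
Variables (R : realType) (H H' : completeNormedModType R[i]).
Variables (ip : {dot H for Num.conj}) (ip' : {dot H' for Num.conj}).
Hypothesis hip' : hilbert_ip ip'.
Variables (M : countType) (Mk : nat -> {fset M}).
Hypothesis hMk : exhaustion Mk.
Variables (e : M -> H) (m : nat) (B : 'I_m.+1 -> linop H H').
Hypothesis he : orthonormal_basis Mk ip e.
Hypothesis hBdom : forall j n, opdom (B j) (e n).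
Hypothesis hBorth : forall j n' n'', n' != n'' ->
  ip' (B j (e n')) (B j (e n'')) = 0.
Variables (A : linop H H') (lam : 'I_m.+1 -> R).
Hypothesis hAdom : forall n, opdom A (e n).
Hypothesis hlam : forall j, 0 < lam j.
Hypothesis hlam1 : \sum_(j < m.+1) lam j = 1.

Lemma sum_bnh (s : seq M) (c : M -> R) (h : 'I_m.+1 -> R) :
  \sum_(n <- s) c n * bnh e B h n =
  \sum_(j < m.+1) h j * \sum_(n <- s) c n * rnorm (B j (e n)) ^+ 2.
Proof.
rewrite /bnh; under eq_bigr do rewrite mulr_sumr.
rewrite exchange_big/=; apply: eq_bigr => j _; rewrite mulr_sumr.
by apply: eq_bigr => n _; rewrite mulrCA.
Qed.

(** The additive inequality, before optimising in [h]. Here [0 < C] gives the [0 < S] required by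
    the Cauchy-Schwarz estimate. *)
Lemma rnorm_sqr_le_frakC (C : R) (h : 'I_m.+1 -> R) (x : H) :
  closable_op A -> (forall j, closed_op (B j)) ->
  0 < C -> (frakC Mk ip' e B A lam <= C%:E)%E -> (forall j, 0 < h j) ->
  opdom A x -> HB_space Mk ip e B x ->
  rnorm (A x) ^+ 2 <=
  C / \prod_(j < m.+1) h j `^ lam j * \sum_(j < m.+1) h j * rnorm (B j x) ^+ 2.
Proof.
move=> Acl Bcl C0 hC h0 xA xB.
set S := C / _; pose b := bnh e B h.
have S0 : 0 < S.
  by rewrite divr_gt0//; apply: prodr_gt0 => j _; rewrite powR_gt0.
have b0 n : 0 <= b n by exact: bnh_ge0.
have tsum f : rnorm f <= 1 -> _ := fun f1 =>
  (tilde_sum_le hMk S (fun n => sqr_ge0 (rnorm (ip' f (A (e n))))) b0).1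
    ((frakC_le _ _ _ _ _ _ _).1 hC h h0 f f1).
(* Test with the unit vector along [A (e n)]: a finite tilde sum with [b n = 0] forces
   [(f, A e_n) = 0], yet this pairing equals [|A e_n|]. *)
have bv0 n : b n = 0 -> A (e n) = 0.
  move=> bn; apply/eqP; rewrite -rnorm_eq0; set N := rnorm _.
  have [//|N0] := eqVneq N 0.
  have Nge0 : 0 <= N by exact: rnorm_ge0.
  pose f := (N^-1)%:C%C *: A (e n).
  have f1 : rnorm f <= 1 by rewrite rnormZ rnorm_real ?invr_ge0// mulVf.
  have [/(_ n bn)/eqP + _] := tsum f f1.
  rewrite sqrf_eq0 /f linearZl_LR/= ip_rnorm// -rmorphM/= rnorm_real.
    by rewrite expr2 mulKf// (negPf N0).
  by rewrite mulr_ge0 ?sqr_ge0 ?invr_ge0.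
have xBj : forall j, opdom (B j) x.
  by move=> j; exact: (HB_space_sub_opdom hip' hMk he Bcl hBdom hBorth xB).
have /choice[s hs] : forall j, exists s : R, forall k,
    \sum_(n <- Mk k) rnorm (ip x (e n)) ^+ 2 * rnorm (B j (e n)) ^+ 2 <= s.
  move=> j; apply: sumM_lty => // n.
  by rewrite mulr_ge0 ?sqr_ge0.
have yB j : (fun k => \sum_(n <- Mk k) ip x (e n) *: B j (e n)) @ \oo --> B j x.
  apply: (closable_sumE he (closed_closable (Bcl j)) (hBdom j) (xBj j)).
  apply: (dominated_sum_cvg hMk _ _ (hs j)) => [n|k c]; first exact: sqr_ge0.
  by rewrite (rnorm_sqr_sum_orthogonal hip' _ _ (hBorth j)).
have domA k (c : M -> R[i]) : rnorm (\sum_(n <- Mk k) c n *: A (e n)) ^+ 2 <=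
    S * \sum_(n <- Mk k) rnorm (c n) ^+ 2 * b n.
  by apply: (rnorm_sqr_sum_le hip') => // f /tsum[_ /(_ k)].
have sumS k (c : M -> R[i]) : \sum_(n <- Mk k) rnorm (c n) ^+ 2 * (S * b n) =
    S * \sum_(n <- Mk k) rnorm (c n) ^+ 2 * b n.
  by rewrite mulr_sumr; apply: eq_bigr => n _; rewrite mulrCA.
have yA : (fun k => \sum_(n <- Mk k) ip x (e n) *: A (e n)) @ \oo --> A x.
  apply: (closable_sumE he Acl hAdom xA).
  (* The domination uses weights [S * b n]; exchanging the sums over [n] and [j] bounds the weighted
     sums through the bounds [s j]. *)
  apply: (@dominated_sum_cvg _ _ _ hMk _ _ _ (fun n => S * b n)
    (S * \sum_(j < m.+1) h j * s j)) => [n|k c|k].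
  - by rewrite mulr_ge0// ltW.
  - by rewrite sumS.
  rewrite sumS sum_bnh ler_pM2l//.
  by apply: ler_sum => j _; rewrite ler_pM2l.
pose yBk j k := \sum_(n <- Mk k) ip x (e n) *: B j (e n).
have lA : rnorm (\sum_(n <- Mk k) ip x (e n) *: A (e n)) ^+ 2 @[k --> \oo] -->
    rnorm (A x) ^+ 2.
  by rewrite expr2; under eq_fun do rewrite expr2; apply: cvgM; exact: (cvg_rnorm yA).
have lB : S * (\sum_(j < m.+1) h j * rnorm (yBk j k) ^+ 2) @[k --> \oo] -->
    S * \sum_(j < m.+1) h j * rnorm (B j x) ^+ 2.
  apply: cvgM; first exact: cvg_cst.
  apply: (cvg_big add_continuous) => j _.
  apply: cvgM; first exact: cvg_cst.
  by rewrite expr2; under eq_fun do rewrite expr2; apply: cvgM; exact: (cvg_rnorm (yB j)).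
(* The inequality holds for each finite partial sum and passes to the limit. *)
apply: (ler_cvg_to lA lB); near=> k.
apply: le_trans (domA k _) _; rewrite ler_pM2l// sum_bnh.
apply: ler_sum => j _; rewrite ler_pM2l//.
by rewrite /yBk (rnorm_sqr_sum_orthogonal hip' _ _ (hBorth j)).
Unshelve. all: end_near.
Qed.


(** Test with all [h j = 1] and [f = 0]. Applied to a negative bound, this also excludes the value
    [-oo]. *)
Lemma frakC_ge0 (C : R) : (frakC Mk ip' e B A lam <= C%:E)%E -> 0 <= C.
Proof.
have h0 (j : 'I_m.+1) : (0 : R) < 1 by [].
have f1 : rnorm (0 : H') <= 1 by rewrite rnorm0.
move=> /frakC_le/(_ _ h0 0 f1)/tilde_sum_le h.
have [//||_ /(_ 0%N)] := h hMk; first by move=> n; exact: sqr_ge0.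
  by move=> n; exact: bnh_ge0.
have -> : \prod_(j < m.+1) (1 : R) `^ lam j = 1.
  by rewrite big1// => j _; rewrite powR1.
by rewrite divr1; apply: le_trans; apply: sumr_ge0 => n _;
  rewrite divr_ge0 ?sqr_ge0 ?bnh_ge0.
Qed.

Lemma HB_space_finite k (x : H) :
  (forall n, n \notin Mk k -> ip x (e n) = 0) -> HB_space Mk ip e B x.
Proof.
move=> x0 j; apply: (sumM_finite_support_lty hMk (k := k)) => n.
  by rewrite mulr_ge0 ?sqr_ge0.
by move=> /x0->; rewrite rnorm0 expr0n mul0r.
Qed.

Lemma HB_space_basis n : HB_space Mk ip e B (e n).
Proof.
have [_ /(_ n)[k nk]] := hMk; apply: (@HB_space_finite k) => n' n'k.
rewrite he.1; case: eqP => // nn'; by rewrite nn' (negPf n'k) in nk.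
Qed.

(** For the test vector, [T <= |A x| <= K P] and [p P^2 / L <= T] give
    [T^2 p <= K^2 P^2 p <= K^2 T L]; then divide by [T]. *)
Lemma frakC_le_of_bound (K : R) : 0 <= K ->
  (forall x, opdom A x -> HB_space Mk ip e B x ->
     rnorm (A x) <= K * \prod_(j < m.+1) rnorm (B j x) `^ lam j) ->
  (frakC Mk ip' e B A lam <= (K ^+ 2 * \prod_(j < m.+1) lam j `^ lam j)%:E)%E.
Proof.
move=> K0 bound; apply/frakC_le => h h0 f f1; pose b := bnh e B h.
have b0 n : 0 <= b n by exact: bnh_ge0.
set L := \prod_(j < m.+1) lam j `^ lam j; set p := \prod_(j < m.+1) _.
have L0 : 0 < L by apply: prodr_gt0 => j _; rewrite powR_gt0.
have p0 : 0 < p by apply: prodr_gt0 => j _; rewrite powR_gt0.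
apply/(tilde_sum_le hMk _ (fun n => sqr_ge0 _) b0); split => [n bn|k].
  (* If [b n = 0], every [B j] kills [e n], so the assumed bound at [x = e n] kills [A (e n)] and
     the tilde sum is not forced to [+oo]. *)
  have Bn j : B j (e n) = 0.
    apply/eqP; rewrite -rnorm_eq0 -sqrf_eq0.
    have := @psumr_eq0P _ _ predT (fun j => h j * rnorm (B j (e n)) ^+ 2).
    move=> /(_ (fun i _ => mulr_ge0 (ltW (h0 i)) (sqr_ge0 _)) bn j isT)/eqP.
    by rewrite mulf_eq0 (gt_eqF (h0 j)).
  have := bound _ (hAdom n) (HB_space_basis n).
  rewrite (bigD1 ord0)//= Bn rnorm0 powR0 ?gt_eqF// mul0r mulr0.
  rewrite le_eqVlt ltNge rnorm_ge0 orbF rnorm_eq0 => /eqP->.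
  by rewrite linear0r rnorm0 expr0n.
(* [c n = 0] when [b n = 0], since then [(b n)^-1 = 0]. *)
pose a n := ip' f (A (e n)).
pose c n : R[i] := a n * ((b n)^-1)%:C%C.
set T := \sum_(n <- Mk k) _.
have T0 : 0 <= T by apply: sumr_ge0 => n _; rewrite divr_ge0 ?sqr_ge0.
have cT : \sum_(n <- Mk k) rnorm (c n) ^+ 2 * b n = T.
  apply: eq_bigr => n _; rewrite /c rnormM rnorm_real ?invr_ge0//.
  rewrite exprMn -mulrA; congr (_ * _).
  have [bn0|bn0] := eqVneq (b n) 0; first by rewrite bn0 mulr0 invr0.
  by rewrite expr2 -mulrA mulVf// mulr1.
pose x := \sum_(n <- Mk k) c n *: e n.
have [xA AxE] := opdom_sum (Mk k) c hAdom.
have xB : HB_space Mk ip e B x.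
  apply: (@HB_space_finite k) => n nk.
  rewrite linear_sumlz/= big_seq big1// => n' n'k.
  rewrite linearZl_LR/= he.1; case: eqP => [nn'|_]; last by rewrite mulr0.
  by rewrite -nn' n'k in nk.
have TAx : T <= rnorm (A x).
  apply: (ip_le_rnorm hip' _ f1 T0).
  rewrite AxE linear_sumlz/= rmorph_sum/=; apply: eq_bigr => n _.
  rewrite linearZl_LR/= /c.
  have -> : ip' (A (e n)) f = Num.conj (a n).
    by apply: etrans (hermC _ _ _) _; rewrite mul1r.
  by rewrite mulrAC -normCK -rnormE rmorphM/= rmorphXn.
pose P := \prod_(j < m.+1) rnorm (B j x) `^ lam j.
have P0 : 0 <= P by apply: prodr_ge0 => j _; exact: powR_ge0.
(* Weighted AM-GM for the numbers [h_j |B_j x|^2 / lam_j], whose weighted mean is [T]. *)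
have PT : p * P ^+ 2 / L <= T.
  have -> : T = \sum_(j < m.+1) lam j * (h j * rnorm (B j x) ^+ 2 / lam j).
    rewrite -cT sum_bnh; apply: eq_bigr => j _.
    rewrite [RHS]mulrC mulfVK ?gt_eqF//.
    have [_ ->] := opdom_sum (Mk k) c (hBdom j).
    by rewrite (rnorm_sqr_sum_orthogonal hip' _ _ (hBorth j)).
  apply: le_trans _ (prod_powR_le_sum hlam hlam1 _); last first.
    by move=> j; exact: divr_ge0 (mulr_ge0 (ltW (h0 j)) (sqr_ge0 _)) (ltW (hlam j)).
  rewrite le_eqVlt; apply/orP; left; apply/eqP.
  rewrite -prodrXl -big_split -prodf_div/=; apply: eq_bigr => j _.
  have l0 := ltW (hlam j); have hj0 := ltW (h0 j).
  have r0 := rnorm_ge0 (B j x).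
  rewrite !expr2 !powRM ?invr_ge0 ?mulr_ge0//.
  by rewrite -(powR_inv1 l0) -powRrM mulN1r powRN.
have [->|Tn0] := eqVneq T 0.
  by rewrite divr_ge0 ?mulr_ge0 ?sqr_ge0// ltW.
have Tgt0 : 0 < T by rewrite lt_neqAle eq_sym Tn0.
rewrite ler_pdivlMr// -(ler_pM2l Tgt0).
have KP : T ^+ 2 <= (K * P) ^+ 2.
  rewrite ler_pXn2r ?nnegrE ?mulr_ge0//.
  exact: le_trans TAx (bound _ xA xB).
have PT' : P ^+ 2 * p <= T * L by rewrite mulrC -ler_pdivrMr.
apply: (@le_trans _ _ (K ^+ 2 * (P ^+ 2 * p))).
  have -> : T * (T * p) = T ^+ 2 * p by rewrite mulrA.
  by rewrite mulrA -exprMn ler_pM2r.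
by rewrite [leRHS]mulrCA ler_wpM2l ?sqr_ge0.
Qed.

Lemma rnorm_le_frakC (C : R) (x : H) :
  closable_op A -> (forall j, closed_op (B j)) ->
  (frakC Mk ip' e B A lam <= C%:E)%E ->
  opdom A x -> HB_space Mk ip e B x ->
  rnorm (A x) <= Num.sqrt (C * \prod_(j < m.+1) lam j `^ (- lam j)) *
    \prod_(j < m.+1) rnorm (B j x) `^ lam j.
Proof.
move=> Acl Bcl hC xA xB; have C0 := frakC_ge0 hC.
set L := \prod_(j < m.+1) lam j `^ (- lam j).
have L0 : 0 < L by apply: prodr_gt0 => j _; rewrite powR_gt0.
pose y j := rnorm (B j x); have y0 j : 0 <= y j by exact: rnorm_ge0.
pose Q t := \prod_(j < m.+1) (y j ^+ 2 + t) `^ lam j.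
set P := \prod_(j < m.+1) _.
have P0 : 0 <= P by apply: prodr_ge0 => j _; exact: powR_ge0.
have bnd t : 0 < t -> rnorm (A x) ^+ 2 <= (C + t) * L * Q t.
  move=> t0; have yt0 j : 0 < y j ^+ 2 + t by rewrite ltr_wpDl// sqr_ge0.
  (* This makes [sum_j h_j y_j^2 <= sum_j lam_j = 1] and the inverse product equal to [L * Q t].
     Enlarging [C] to [C + t] secures positivity when [C = 0]. *)
  pose h j := lam j / (y j ^+ 2 + t).
  have h0 j : 0 < h j by rewrite divr_gt0.
  have hCt : (frakC Mk ip' e B A lam <= (C + t)%:E)%E.
    by apply: le_trans hC _; rewrite lee_fin lerDl ltW.
  have Ct0 : 0 < C + t by rewrite ltr_wpDl.
  apply: le_trans (rnorm_sqr_le_frakC Acl Bcl Ct0 hCt h0 xA xB) _.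
  have -> : (\prod_(j < m.+1) h j `^ lam j)^-1 = L * Q t.
    rewrite -prodfV -big_split/=; apply: eq_bigr => j _.
    have := hlam j; have := yt0 j => /ltW yj /ltW lj.
    rewrite powRM ?invr_ge0// invfM -powRN -powR_inv1// -powRrM -powRN.
    by rewrite mulN1r opprK.
  rewrite mulrA ler_piMr//.
    rewrite !mulr_ge0// ltW//; apply: prodr_gt0 => j _; exact: powR_gt0.
  rewrite -hlam1; apply: ler_sum => j _.
  rewrite /h mulrAC ler_pdivrMr// ler_pM2l// lerDl ltW//.
have lim : (C + t) * L * Q t @[t --> 0^'+] --> (C + 0) * L * P ^+ 2.
  have -> : P ^+ 2 = \prod_(j < m.+1) (y j ^+ 2) `^ lam j.
    by rewrite -prodrXl; apply: eq_bigr => j _; rewrite !expr2 powRM.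
  apply: cvgM.
    apply: cvgM; last exact: cvg_cst.
    apply: cvgD; first exact: cvg_cst.
    by apply: cvg_at_right_filter; exact: cvg_id.
  apply: (cvg_big mul_continuous) => j _.
  by apply: cvg_powRD_right => //; exact: sqr_ge0.
have : rnorm (A x) ^+ 2 <= C * L * P ^+ 2.
  rewrite -{1}[C]addr0; apply: (ler_cvg_to (cvg_cst _) lim).
  by near=> t; apply: bnd.
move=> le_sqr; rewrite -(@ler_pXn2r _ 2) ?nnegrE ?rnorm_ge0 ?mulr_ge0 ?sqrtr_ge0//.
by rewrite exprMn sqr_sqrtr// mulr_ge0// ltW.
Unshelve. all: end_near.
Qed.

End Kolmogorov.

(** * Assembly of the inequality and its sharpness *)

Theorem theorem8 (R : realType)
    (H H' : completeNormedModType R[i])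
    (ip : {dot H for Num.conj}) (ip' : {dot H' for Num.conj})
    (hip : hilbert_ip ip) (hip' : hilbert_ip ip')
    (M : countType) (Mk : nat -> {fset M}) (hMk : exhaustion Mk)
    (e : M -> H) (he : orthonormal_basis Mk ip e)
    (m : nat) (B : 'I_m.+1 -> linop H H')
    (hBclosed : forall j, closed_op (B j))
    (hBdom : forall j n, opdom (B j) (e n))
    (hBorth : forall j n' n'', n' != n'' ->
       ip' (B j (e n')) (B j (e n'')) = 0)
    (hBnz : exists j0 n0, B j0 (e n0) != 0)
    (A : linop H H') (hA : closable_op A)
    (hAdom : forall n, opdom A (e n))
    (hAnz : exists n0, A (e n0) != 0)
    (lam : 'I_m.+1 -> R) (hlam : forall j, 0 < lam j)
    (hlam1 : \sum_(j < m.+1) lam j = 1)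
    (hC : (frakC Mk ip' e B A lam < +oo)%E) :
  let C0 := Num.sqrt (fine (frakC Mk ip' e B A lam) *
                      \prod_(j < m.+1) lam j `^ (- lam j)) in
  (forall x, (opdom A `&` HB_space Mk ip e B) x ->
     rnorm (A x) <= C0 * \prod_(j < m.+1) rnorm (B j x) `^ lam j) /\
  (forall K : R,
     (forall x, (opdom A `&` HB_space Mk ip e B) x ->
        rnorm (A x) <= K * \prod_(j < m.+1) rnorm (B j x) `^ lam j) ->
     C0 <= K).
Proof.
set C := frakC _ _ _ _ _ _ => C0.
have C_fin : C = (fine C)%:E.
  apply/esym/fineK; rewrite fin_numE (lt_eqF hC) andbT; apply/eqP => Coo.
  have : (C <= (-1)%:E)%E by rewrite Coo leNye.
  by move=> /(frakC_ge0 hMk); rewrite oppr_ge0 ler10.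
split=> [x [xA xB]|K bound].
  by apply: (rnorm_le_frakC hip' hMk he hBdom hBorth hAdom hlam hlam1 hA
    hBclosed _ xA xB); rewrite -C_fin.
have [n An] := hAnz.
(* A negative [K] would make the right side nonpositive at [x = e n], where [A x != 0]. *)
have K0 : 0 <= K.
  have An0 : 0 < rnorm (A (e n)).
    by rewrite lt_neqAle eq_sym rnorm_eq0 An rnorm_ge0.
  have := bound _ (conj (hAdom n) (HB_space_basis hMk B he n)).
  move=> /(lt_le_trans An0); apply: contraTle => Kneg; rewrite -leNgt.
  apply: mulr_le0_ge0; first exact: ltW.
  by apply: prodr_ge0 => j _; exact: powR_ge0.
have : (C <= (K ^+ 2 * \prod_(j < m.+1) lam j `^ lam j)%:E)%E.
  apply: (frakC_le_of_bound hip' hMk he hBdom hBorth hAdom hlam hlam1 K0).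
  by move=> x xA xB; exact: bound.
have L0 : 0 < \prod_(j < m.+1) lam j `^ lam j.
  by apply: prodr_gt0 => j _; rewrite powR_gt0.
rewrite C_fin lee_fin -ler_pdivrMr// => CK.
rewrite /C0 -[leRHS]ger0_norm// -sqrtr_sqr ler_wsqrtr//.
apply: le_trans CK; rewrite -prodfV le_eqVlt; apply/orP; left; apply/eqP.
by congr (_ * _); apply: eq_bigr => j _; rewrite powRN.
Qed.
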